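(* For each unimodal signature $\mathcal{L}$, the class of $\mathcal{L}$-unimodal algebras is canonical, i.e. closed under canonical extensions: if $\mathbf{A}$ is an $\mathcal{L}$-unimodal algebra, then the complex algebra of the canonical frame of $\mathbf{A}$ is an $\mathcal{L}$-unimodal algebra.
   Context: Modal symbols: $\Box_{+},\Box_{-},\Diamond_{+},\Diamond_{-}$; a unimodal signature $\mathcal{L}$ is a subset of these. An $\mathcal{L}$-modal algebra is a bounded distributive lattice with one unary operation per symbol in $\mathcal{L}$ satisfying the applicable identities $\Box_{+}(a\wedge b)=\Box_{+}a\wedge\Box_{+}b$, $\Box_{+}\top=\top$; $\Box_{-}(a\vee b)=\Box_{-}a\wedge\Box_{-}b$, $\Box_{-}\bot=\top$; $\Diamond_{+}(a\vee b)=\Diamond_{+}a\vee\Diamond_{+}b$, $\Diamond_{+}\bot=\bot$; $\Diamond_{-}(a\wedge b)=\Diamond_{-}a\vee\Diamond_{-}b$, $\Diamond_{-}\top=\bot$. An $\mathcal{L}$-unimodal algebra is an $\mathcal{L}$-modal algebra satisfying, for all $a,b,c$, each of the following whose two labelling symbols belong to $\mathcal{L}$: $(\Box_{+},\Box_{-})$: $\Box_{-}a\wedge\Box_{+}(a\vee b)\leq\Box_{+}b$; $(\Box_{-},\Box_{+})$: $\Box_{+}a\wedge\Box_{-}(a\wedge b)\leq\Box_{-}b$; $(\Diamond_{+},\Diamond_{-})$: $\Diamond_{+}b\leq\Diamond_{+}(a\wedge b)\vee\Diamond_{-}a$; $(\Diamond_{-},\Diamond_{+})$: $\Diamond_{-}b\leq\Diamond_{-}(a\vee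 b)\vee\Diamond_{+}a$; $(\Box_{+},\Diamond_{-})$: $\Diamond_{-}a\wedge c\leq\Box_{+}a\Rightarrow c\leq\Box_{+}a$; $(\Box_{-},\Diamond_{+})$: $\Diamond_{+}a\wedge c\leq\Box_{-}a\Rightarrow c\leq\Box_{-}a$; $(\Diamond_{+},\Box_{-})$: $\Diamond_{+}a\leq\Box_{-}a\vee c\Rightarrow\Diamond_{+}a\leq c$; $(\Diamond_{-},\Box_{+})$: $\Diamond_{-}a\leq\Box_{+}a\vee c\Rightarrow\Diamond_{-}a\leq c$; $(\Box_{+},\Diamond_{+})$: $\Diamond_{+}b\wedge c\leq\Box_{+}a\Rightarrow\Box_{+}(a\vee b)\wedge c\leq\Box_{+}a$; $(\Box_{-},\Diamond_{-})$: $\Diamond_{-}b\wedge c\leq\Box_{-}a\Rightarrow\Box_{-}(a\wedge b)\wedge c\leq\Box_{-}a$; $(\Diamond_{+},\Box_{+})$: $\Diamond_{+}a\leq\Box_{+}b\vee c\Rightarrow\Diamond_{+}a\leq\Diamond_{+}(a\wedge b)\vee c$; $(\Diamond_{-},\Box_{-})$: $\Diamond_{-}a\leq\Box_{-}b\vee c\Rightarrow\Diamond_{-}a\leq\Diamond_{-}(a\vee b)\vee c$. The canonical frame of $\mathbf{A}$: prime filters ordered by inclusion, with $\mathcal{U}R^{\Box}_{+}\mathcal{V}$ iff ($\Box_{+}a\in\mathcal{U}\Rightarrow a\in\mathcal{V}$ for all $a$); $\mathcal{U}R^{\Box}_{-}\mathcal{V}$ iff ($\Box_{-}a\in\mathcal{U}\Rightarrow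 a\notin\mathcal{V}$); $\mathcal{U}R^{\Diamond}_{+}\mathcal{V}$ iff ($a\in\mathcal{V}\Rightarrow\Diamond_{+}a\in\mathcal{U}$); $\mathcal{U}R^{\Diamond}_{-}\mathcal{V}$ iff ($a\notin\mathcal{V}\Rightarrow\Diamond_{-}a\in\mathcal{U}$). The complex algebra of a poset $(W,\leq)$ with relations $R^{\Delta}_{\alpha}$ is the lattice of upsets with $\Box_{+}a=\{u:\forall v\,(uR^{\Box}_{+}v\Rightarrow v\in a)\}$, $\Box_{-}a=\{u:\forall v\,(uR^{\Box}_{-}v\Rightarrow v\notin a)\}$, $\Diamond_{+}a=\{u:\exists v\in a,\ uR^{\Diamond}_{+}v\}$, $\Diamond_{-}a=\{u:\exists v\notin a,\ uR^{\Diamond}_{-}v\}$. The canonical extension of $\mathbf{A}$ is the complex algebra of its canonical frame. *)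

(* Defs.v *)
From HB Require Import structures.
From mathcomp Require Import all_boot all_order.
From mathcomp Require Import boolp classical_sets.

Set Implicit Arguments.
Unset Strict Implicit.
Unset Printing Implicit Defensive.

Import Order.TTheory.
Local Open Scope order_scope.

Inductive modality := BoxP | BoxM | DiaP | DiaM.

Record algebra (L : set modality) := Algebra {
  alg_disp : Order.disp_t;
  alg_sort :> tbDistrLatticeType alg_disp;
  op : forall s : modality, s \in L -> alg_sort -> alg_sort }.
Arguments op {L} A {s} _ _ : rename.

Record modal_algebra (L : set modality) (A : algebra L) : Prop := {
  BoxP_meet : forall (bp : BoxP \in L) (a b : A),
    op A bp (a `&` b) = op A bp a `&` op A bp b;
  BoxP_top : forall bp : BoxP \in L, op A bp \top = \top;
  BoxM_join : forall (bm : BoxM \in L) (a b : A),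
    op A bm (a `|` b) = op A bm a `&` op A bm b;
  BoxM_bot : forall bm : BoxM \in L, op A bm \bot = \top;
  DiaP_join : forall (dp : DiaP \in L) (a b : A),
    op A dp (a `|` b) = op A dp a `|` op A dp b;
  DiaP_bot : forall dp : DiaP \in L, op A dp \bot = \bot;
  DiaM_meet : forall (dm : DiaM \in L) (a b : A),
    op A dm (a `&` b) = op A dm a `|` op A dm b;
  DiaM_top : forall dm : DiaM \in L, op A dm \top = \bot }.

Record unimodal_algebra (L : set modality) (A : algebra L) : Prop := {
  unimodal_modal : modal_algebra A;
  BoxP_BoxM : forall (bp : BoxP \in L) (bm : BoxM \in L) (a b : A),
    op A bm a `&` op A bp (a `|` b) <= op A bp b;
  BoxM_BoxP : forall (bm : BoxM \in L) (bp : BoxP \in L) (a b : A),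
    op A bp a `&` op A bm (a `&` b) <= op A bm b;
  DiaP_DiaM : forall (dp : DiaP \in L) (dm : DiaM \in L) (a b : A),
    op A dp b <= op A dp (a `&` b) `|` op A dm a;
  DiaM_DiaP : forall (dm : DiaM \in L) (dp : DiaP \in L) (a b : A),
    op A dm b <= op A dm (a `|` b) `|` op A dp a;
  BoxP_DiaM : forall (bp : BoxP \in L) (dm : DiaM \in L) (a c : A),
    op A dm a `&` c <= op A bp a -> c <= op A bp a;
  BoxM_DiaP : forall (bm : BoxM \in L) (dp : DiaP \in L) (a c : A),
    op A dp a `&` c <= op A bm a -> c <= op A bm a;
  DiaP_BoxM : forall (dp : DiaP \in L) (bm : BoxM \in L) (a c : A),
    op A dp a <= op A bm a `|` c -> op A dp a <= c;
  DiaM_BoxP : forall (dm : DiaM \in L) (bp : BoxP \in L) (a c : A),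
    op A dm a <= op A bp a `|` c -> op A dm a <= c;
  BoxP_DiaP : forall (bp : BoxP \in L) (dp : DiaP \in L) (a b c : A),
    op A dp b `&` c <= op A bp a -> op A bp (a `|` b) `&` c <= op A bp a;
  BoxM_DiaM : forall (bm : BoxM \in L) (dm : DiaM \in L) (a b c : A),
    op A dm b `&` c <= op A bm a -> op A bm (a `&` b) `&` c <= op A bm a;
  DiaP_BoxP : forall (dp : DiaP \in L) (bp : BoxP \in L) (a b c : A),
    op A dp a <= op A bp b `|` c -> op A dp a <= op A dp (a `&` b) `|` c;
  DiaM_BoxM : forall (dm : DiaM \in L) (bm : BoxM \in L) (a b c : A),
    op A dm a <= op A bm b `|` c -> op A dm a <= op A dm (a `|` b) `|` c }.

Section Upsets.
Context {d : Order.disp_t} (W : porderType d).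

Definition is_upset : {pred set W} :=
  [pred a : set W | `[< forall u v, u <= v -> a u -> a v >]].

Lemma is_upsetP (a : set W) :
  reflect (forall u v, u <= v -> a u -> a v) (a \in is_upset).
Proof. exact: asboolP. Qed.

Fact is_upset_meet : {in is_upset &, forall a b : set W, a `&` b \in is_upset}.
Proof.
move=> a b /is_upsetP ha /is_upsetP hb; apply/is_upsetP => u v uv [au bu].
by split; [apply: ha au|apply: hb bu].
Qed.

Fact is_upset_join : {in is_upset &, forall a b : set W, a `|` b \in is_upset}.
Proof.
move=> a b /is_upsetP ha /is_upsetP hb; apply/is_upsetP => u v uv.
by move=> [/(ha _ _ uv)|/(hb _ _ uv)]; [left|right].
Qed.

Fact is_upset_bot : (\bot : set W) \in is_upset.
Proof. exact/is_upsetP. Qed.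

Fact is_upset_top : (\top : set W) \in is_upset.
Proof. exact/is_upsetP. Qed.

Record upset := Upset { upset_set :> set W; _ : upset_set \in is_upset }.

HB.instance Definition _ := [isSub for upset_set].
HB.instance Definition _ := [Choice of upset by <:].
HB.instance Definition _ := Order.SubChoice_isTBSubLattice.Build
  set_display (set W) (mem is_upset) set_display upset
  is_upset_meet is_upset_join is_upset_bot is_upset_top.

Fact upset_meetUl : @left_distributive upset upset Order.meet Order.join.
Proof. by move=> a b c; apply: val_inj; apply: meetUl. Qed.

HB.instance Definition _ :=
  Order.Lattice_Meet_isDistrLattice.Build set_display upset upset_meetUl.

End Upsets.

(* The weakest conditions on R under which the operation of the complex algebra
   attached to s maps upsets to upsets. *)
Definition compatible (s : modality) {d : Order.disp_t} {W : porderType d}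
    (R : W -> W -> Prop) : Prop :=
  match s with
  | BoxP => forall u u' v', u <= u' -> R u' v' -> exists2 v, v <= v' & R u v
  | BoxM => forall u u' v', u <= u' -> R u' v' -> exists2 v, v' <= v & R u v
  | DiaP => forall u u' v, u <= u' -> R u v -> exists2 v', v <= v' & R u' v'
  | DiaM => forall u u' v, u <= u' -> R u v -> exists2 v', v' <= v & R u' v'
  end.

Record frame (L : set modality) := Frame {
  frame_disp : Order.disp_t;
  frame_sort :> porderType frame_disp;
  frame_rel : forall s : modality, s \in L -> frame_sort -> frame_sort -> Prop;
  frame_compatible : forall (s : modality) (sL : s \in L),
    compatible s (frame_rel sL) }.
Arguments frame_rel {L} F {s} _ _ _ : rename.

Section ComplexAlgebra.
Context (L : set modality) (F : frame L).

Definition complex_set (s : modality) (sL : s \in L) (a : set F) : set F :=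
  match s with
  | BoxP => [set u | forall v, frame_rel F sL u v -> a v]
  | BoxM => [set u | forall v, frame_rel F sL u v -> ~ a v]
  | DiaP => [set u | exists2 v, a v & frame_rel F sL u v]
  | DiaM => [set u | exists2 v, ~ a v & frame_rel F sL u v]
  end.

Fact complex_set_upset (s : modality) (sL : s \in L) (a : upset F) :
  complex_set sL a \in @is_upset _ F.
Proof.
have /is_upsetP ha := valP a.
apply/is_upsetP => u u' uu'.
have := @frame_compatible _ F s sL; case: s sL => sL /= cR.
- move=> h v' /(cR _ _ _ uu')[v vv' /h]; exact: ha.
- by move=> h v' /(cR _ _ _ uu')[v v'v /h nav] /(ha _ _ v'v).
- by case=> v av /(cR _ _ _ uu')[v' vv' Rv']; exists v' => //; apply: ha av.
- case=> v nav /(cR _ _ _ uu')[v' v'v Rv']; exists v' => //.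
  by move=> /(ha _ _ v'v).
Qed.

Definition complex_op (s : modality) (sL : s \in L) (a : upset F) : upset F :=
  Upset (complex_set_upset sL a).

Definition complex_algebra : algebra L := @Algebra L _ (upset F) complex_op.

End ComplexAlgebra.

Section PrimeFilters.
Context {d : Order.disp_t} (A : tbDistrLatticeType d).

Record prime_filter_spec (F : set A) : Prop := {
  pf_top : F \top;
  pf_up : forall a b, a <= b -> F a -> F b;
  pf_meet : forall a b, F a -> F b -> F (a `&` b);
  pf_bot : ~ F \bot;
  pf_join : forall a b, F (a `|` b) -> F a \/ F b }.

Definition is_prime_filter : {pred set A} :=
  [pred F : set A | `[< prime_filter_spec F >]].

Record prime_filter := PrimeFilter {
  pf_set :> set A; _ : pf_set \in is_prime_filter }.

HB.instance Definition _ := [isSub for pf_set].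
HB.instance Definition _ := [Choice of prime_filter by <:].
HB.instance Definition _ := Order.SubChoice_isSubPOrder.Build
  set_display (set A) (mem is_prime_filter) set_display prime_filter.

Lemma prime_filterP (U : prime_filter) : prime_filter_spec U.
Proof. by have /asboolP := valP U. Qed.

Lemma prime_filter_leP (U V : prime_filter) : U <= V <-> (U `<=` V)%classic.
Proof. by rewrite -(rwP (subsetPset U V)). Qed.

End PrimeFilters.

Section CanonicalExtension.
Context (L : set modality) (A : algebra L).

Definition canonical_rel (s : modality) (sL : s \in L)
    (U V : prime_filter A) : Prop :=
  match s with
  | BoxP => forall a : A, pf_set U (op A sL a) -> pf_set V a
  | BoxM => forall a : A, pf_set U (op A sL a) -> ~ pf_set V a
  | DiaP => forall a : A, pf_set V a -> pf_set U (op A sL a)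
  | DiaM => forall a : A, ~ pf_set V a -> pf_set U (op A sL a)
  end.

Fact canonical_rel_compatible (s : modality) (sL : s \in L) :
  compatible s (canonical_rel sL).
Proof.
by case: s sL => sL U U' V /prime_filter_leP UU' R; exists V => // a;
   [move=> /UU'/R|move=> /UU'/R|move=> /R/UU'|move=> /R/UU'].
Qed.

Definition canonical_frame : frame L :=
  @Frame L _ (prime_filter A) canonical_rel canonical_rel_compatible.

Definition canonical_extension : algebra L := complex_algebra canonical_frame.

End CanonicalExtension.

(* Main.v *)
Require Import Defs.
From mathcomp Require Import all_boot all_order.
From mathcomp Require Import boolp classical_sets.

(** Each unimodality axiom forces a first-order condition on the canonical
    frame, which in turn validates the axiom in the complex algebra.  For
    instance the axiom of (Box+, Box-) yields: if [U R V] for the relation of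
    Box+, then some [V' <= V] is related to [U] for both Box+ and Box-.  The
    witnesses come from the prime filter theorem.  The axioms linking Box and
    Diamond of the same sign need two witnesses, [U'] and [V']: one first moves
    [V] to a prime filter [V'] which is extremal among those related to [U], and
    then moves [U] to [U']; extremality of [V'] is a finitary condition on
    elements of the algebra and supplies the join (or meet) occurring in the
    axiom. *)

Set Implicit Arguments.
Unset Strict Implicit.
Unset Printing Implicit Defensive.

Import Order.TTheory.
Local Open Scope classical_set_scope.
Local Open Scope order_scope.

(** * Upsets, read pointwise *)

Section UpsetLattice.
Context {d : Order.disp_t} {W : porderType d}.
Implicit Types a b : upset W.

Lemma upset_leP a b : a <= b <-> (upset_set a `<=` upset_set b).
Proof. by rewrite -(rwP (subsetPset a b)). Qed.

Lemma upset_eqP a b : (forall u, upset_set a u <-> upset_set b u) -> a = b.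
Proof. by move=> ab; apply/val_inj/seteqP; split=> u /ab. Qed.

Lemma upset_meetE a b u : upset_set (a `&` b) u = (upset_set a u /\ upset_set b u).
Proof. by []. Qed.

Lemma upset_joinE a b u : upset_set (a `|` b) u = (upset_set a u \/ upset_set b u).
Proof. by []. Qed.

Lemma upset_up a u v : u <= v -> upset_set a u -> upset_set a v.
Proof. by have /is_upsetP := valP a; apply. Qed.

End UpsetLattice.

(** * Filtered and directed sets, and their images under monotone and antitone maps *)

Section Directedness.
Context {d : Order.disp_t} {T : porderType d}.

(** A filter base rather than a filter: the image of a prime filter under a modal operation need not
    be an upset, but remains a base. *)
Definition filtered (X : set T) :=
  X !=set0 /\ forall x y, X x -> X y -> exists2 z, X z & z <= x /\ z <= y.

Definition directed (X : set T) :=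
  X !=set0 /\ forall x y, X x -> X y -> exists2 z, X z & x <= z /\ y <= z.

Lemma filtered_image_homo (X : set T) (f : T -> T) :
  {homo f : x y / x <= y} -> filtered X -> filtered (f @` X).
Proof.
move=> fH [[x0 Xx0] XX]; split; first by exists (f x0); exists x0.
move=> _ _ [x Xx <-] [y Xy <-]; have [z Xz [zx zy]] := XX _ _ Xx Xy.
by exists (f z); [exists z|split; apply: fH].
Qed.

Lemma directed_image_homo (X : set T) (f : T -> T) :
  {homo f : x y / x <= y} -> directed X -> directed (f @` X).
Proof.
move=> fH [[x0 Xx0] XX]; split; first by exists (f x0); exists x0.
move=> _ _ [x Xx <-] [y Xy <-]; have [z Xz [xz yz]] := XX _ _ Xx Xy.
by exists (f z); [exists z|split; apply: fH].
Qed.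

Lemma filtered_image_nhomo (X : set T) (f : T -> T) :
  {homo f : x y /~ x <= y} -> directed X -> filtered (f @` X).
Proof.
move=> fH [[x0 Xx0] XX]; split; first by exists (f x0); exists x0.
move=> _ _ [x Xx <-] [y Xy <-]; have [z Xz [xz yz]] := XX _ _ Xx Xy.
by exists (f z); [exists z|split; apply: fH].
Qed.

Lemma directed_image_nhomo (X : set T) (f : T -> T) :
  {homo f : x y /~ x <= y} -> filtered X -> directed (f @` X).
Proof.
move=> fH [[x0 Xx0] XX]; split; first by exists (f x0); exists x0.
move=> _ _ [x Xx <-] [y Xy <-]; have [z Xz [zx zy]] := XX _ _ Xx Xy.
by exists (f z); [exists z|split; apply: fH].
Qed.

End Directedness.

(** * The prime filter theorem, its extremal form and its relative forms *)

Section PrimeFilterTheorem.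
Context {d : Order.disp_t} {A : tbDistrLatticeType d}.
Implicit Types (X Y : set A) (U V : prime_filter A).

(** Zorn's lemma gives a maximal ideal [J] that contains [Y] and avoids [X]; its complement is [P].
    The last clause is the maximality of [J] in terms of elements, and it makes [P] minimal among
    the prime filters containing [X]. *)
Lemma prime_filter_separation_min X Y :
  filtered X -> directed Y -> (forall x y, X x -> Y y -> ~ x <= y) ->
  exists P : prime_filter A,
    [/\ X `<=` pf_set P, Y `<=` setC (pf_set P) &
        forall b, pf_set P b ->
          exists w z, [/\ ~ pf_set P w, X z & z <= w `|` b] ].
Proof.
move=> [[x0 Xx0] XX] [[y0 Yy0] YY] XY.
(* The clause about [Y] is conditional because Zorn's lemma also requires the
   empty union to be admissible. *)
pose Q : set (set A) := fun J => [/\ forall a b, a <= b -> J b -> J a,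
  forall a b, J a -> J b -> J (a `|` b), J `<=` setC X & J !=set0 -> Y `<=` J].
have [|J [[Jdown Jjoin JX JY] Jmax]] := @Zorn_bigcup _ Q.
  move=> F FQ Ftot; split.
  - move=> a b ab [J FJ Jb]; exists J => //.
    by have [Jd _ _ _] := FQ _ FJ; apply: Jd Jb.
  - move=> a b [J FJ Ja] [K FK Kb].
    have [JK|KJ] := Ftot _ _ FJ FK.
      exists K => //; have [_ Kj _ _] := FQ _ FK; apply: Kj => //; exact: JK.
    exists J => //; have [_ Jj _ _] := FQ _ FJ; apply: Jj => //; exact: KJ.
  - by move=> a [J FJ Ja]; have [_ _ JnX _] := FQ _ FJ; apply: JnX.
  - move=> [a [J FJ Ja]] y Yy; exists J => //.
    by have [_ _ _ JsY] := FQ _ FJ; apply: JsY => //; exists a.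
(* Were [J] empty, the ideal generated by [Y] would properly extend it. *)
have J0 : J !=set0.
  apply: contrapT => nJ0.
  apply: (Jmax [set a | exists2 y, Y y & a <= y]).
    split; first by move=> a Ja; case: nJ0; exists a.
    by move=> Js; apply: nJ0; exists y0; apply: Js; exists y0.
  split.
  - by move=> a b ab [y Yy by_]; exists y => //; apply: le_trans by_.
  - move=> a b [y Yy ay] [y' Yy' by'].
    have [z Yz [yz y'z]] := YY _ _ Yy Yy'; exists z => //.
    by rewrite leUx (le_trans ay) // (le_trans by').
  - by move=> a [y Yy ay] Xa; apply: (XY _ _ Xa Yy).
  - by move=> _ y Yy; exists y.
(* The ideal generated by [J] and [b] properly extends [J], so it must meet [X]. *)
have Jmin b : ~ J b -> exists w z, [/\ J w, X z & z <= w `|` b].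
  move=> nJb; apply: contrapT => nE.
  apply: (Jmax [set a | exists2 w, J w & a <= w `|` b]).
    split; first by move=> a Ja; exists a; rewrite // leUl.
    have [w Jw] := J0; move=> Js; apply: nJb; apply: Js.
    by exists w; rewrite // leUr.
  split.
  - by move=> a c ac [w Jw cw]; exists w => //; apply: le_trans cw.
  - move=> a c [w Jw aw] [w' Jw' cw]; exists (w `|` w'); first exact: Jjoin.
    rewrite leUx (le_trans aw) ?(le_trans cw) // leU2 ?leUl ?leUr //.
  - by move=> a [w Jw aw] Xa; apply: nE; exists w, a.
  - by move=> _ y Yy; exists y; [apply: JY|rewrite leUl].
have PJ : prime_filter_spec (setC J).
  split.
  - by move=> Jt; apply: (JX x0) => //; apply: Jdown Jt; rewrite lex1.
  - by move=> a b ab nJa Jb; apply: nJa; apply: Jdown Jb.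
  - move=> a b /Jmin [w [z [Jw Xz zw]]] /Jmin [w' [z' [Jw' Xz' zw']]] Jab.
    (* By distributivity this [x] is below the join of [w], [w'] and the meet of [a] and [b], which
       would all lie in [J]. *)
    have [x Xx [xz xz']] := XX _ _ Xz Xz'.
    apply: (JX x) => //; apply: (@Jdown _ ((w `|` w') `|` (a `&` b))).
      rewrite joinIr lexI (le_trans xz) ?(le_trans xz') //.
        by rewrite (le_trans zw') // leU2 ?leUr.
      by rewrite (le_trans zw) // leU2 ?leUl.
    by apply: (Jjoin) => //; apply: Jjoin.
  - by case: J0 => w Jw; apply; apply: Jdown Jw; rewrite le0x.
  - move=> a b nJab; apply: contrapT => /not_orP[/contrapT Ja /contrapT Jb].
    by apply: nJab; apply: Jjoin.
have PJb : setC J \in @is_prime_filter _ A by apply/asboolP.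
exists (PrimeFilter PJb); split => /=.
- by move=> x Xx Jx; apply: (JX x).
- by move=> y Yy /=; apply; apply: JY.
- by move=> b /Jmin[w [z [Jw Xz zw]]]; exists w, z; split => //=; apply.
Qed.

Lemma prime_filter_separation X Y :
  filtered X -> directed Y -> (forall x y, X x -> Y y -> ~ x <= y) ->
  exists2 P : prime_filter A, X `<=` pf_set P & Y `<=` setC (pf_set P).
Proof.
move=> fX dY XY.
by have [P [XP YP _]] := prime_filter_separation_min fX dY XY; exists P.
Qed.

Lemma prime_filter_filtered U : filtered (pf_set U).
Proof.
have [Ut _ Um _ _] := prime_filterP U; split; first by exists \top.
move=> x y Ux Uy; exists (x `&` y); first exact: Um.
by rewrite leIl leIr.
Qed.

Lemma prime_filter_directedC U : directed (setC (pf_set U)).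
Proof.
have [_ _ _ Ub Uj] := prime_filterP U; split; first by exists \bot.
move=> x y nUx nUy; exists (x `|` y); first by case/Uj.
by rewrite leUl leUr.
Qed.

(** Separation is applied to the meets of an element of [U] with an element of [X]: a filter
    containing all of these contains both [U] and [X]. *)
Lemma prime_filter_raise U X Y : filtered X -> directed Y ->
  (forall u x y, pf_set U u -> X x -> Y y -> ~ u `&` x <= y) ->
  exists U', [/\ U <= U', X `<=` pf_set U' & Y `<=` setC (pf_set U')].
Proof.
move=> [[x0 Xx0] XX] dY UXY.
have [Ut _ Um _ _] := prime_filterP U.
pose X' := [set a | exists u x, [/\ pf_set U u, X x & a = u `&` x] ].
have [|x y [u [v [Uu Xv ->]]] Yy|P X'P YP] := @prime_filter_separation X' Y _ dY.
- split; first by exists (\top `&` x0); exists \top, x0.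
  move=> _ _ [u [x [Uu Xx ->]]] [v [y [Uv Xy ->]]].
  have [z Xz [zx zy]] := XX _ _ Xx Xy.
  exists (u `&` v `&` z).
    by exists (u `&` v), z; split => //; apply: Um.
  by split; rewrite leI2 // ?leIl ?leIr.
- exact: UXY.
have Pup := pf_up (prime_filterP P).
exists P; split=> //.
  apply/prime_filter_leP => u Uu; apply: (Pup (u `&` x0)); first exact: leIl.
  by apply: X'P; exists u, x0.
move=> x Xx; apply: (Pup (\top `&` x)); first exact: leIr.
by apply: X'P; exists \top, x.
Qed.

(** Dually, the ideal side is enlarged by the complement of [U]; avoiding that complement is what
    puts [U'] below [U]. *)
Lemma prime_filter_lower U X Y : filtered X -> directed Y ->
  (forall u x y, ~ pf_set U u -> X x -> Y y -> ~ x <= u `|` y) ->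
  exists U', [/\ U' <= U, X `<=` pf_set U' & Y `<=` setC (pf_set U')].
Proof.
move=> fX [[y0 Yy0] YY] UXY.
have [_ _ _ Ub Uj] := prime_filterP U.
pose Y' := [set a | exists u y, [/\ ~ pf_set U u, Y y & a = u `|` y] ].
have [|x y Xx [u [v [Uu Yv ->]]]|P XP Y'P] := @prime_filter_separation X Y' fX.
- split; first by exists (\bot `|` y0); exists \bot, y0.
  move=> _ _ [u [x [Uu Yx ->]]] [v [y [Uv Yy ->]]].
  have [z Yz [xz yz]] := YY _ _ Yx Yy.
  exists (u `|` v `|` z).
    by exists (u `|` v), z; split => //; case/Uj.
  by split; rewrite leU2 // ?leUl ?leUr.
- exact: UXY.
have Pup := pf_up (prime_filterP P).
exists P; split=> //.
  apply/prime_filter_leP => u Pu; apply: contrapT => nUu.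
  apply: (Y'P (u `|` y0)); first by exists u, y0.
  by apply: Pup Pu; rewrite leUl.
move=> y Yy Py; apply: (Y'P (\bot `|` y)); first by exists \bot, y.
by apply: Pup Py; rewrite leUr.
Qed.

Lemma prime_filter_lower_min V X : filtered X -> X `<=` pf_set V ->
  exists V', [/\ V' <= V, X `<=` pf_set V' &
    forall b, pf_set V' b ->
      exists w z, [/\ ~ pf_set V' w, X z & z <= w `|` b] ].
Proof.
move=> fX XV.
have [|P [XP VP Pmin]] :=
  prime_filter_separation_min fX (prime_filter_directedC V).
  by move=> x y /XV Vx nVy xy; apply: nVy; apply: (pf_up (prime_filterP V) xy).
exists P; split=> //; apply/prime_filter_leP => u Pu; apply: contrapT => nVu.
exact: (VP u).
Qed.

End PrimeFilterTheorem.

(** Order dual of [prime_filter_lower_min]. Separation takes place in [A^d], where directed and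
    filtered sets trade places; a prime filter of [A^d] is a prime ideal of [A], and [V'] is its
    complement. *)
Lemma prime_filter_raise_max {d : Order.disp_t} {A : tbDistrLatticeType d}
    (V : prime_filter A) (Y : set A) : directed Y -> Y `<=` setC (pf_set V) ->
  exists V', [/\ V <= V', Y `<=` setC (pf_set V') &
    forall b, ~ pf_set V' b ->
      exists w z, [/\ pf_set V' w, Y z & w `&` b <= z] ].
Proof.
move=> dY YV.
have [|P [XP VP Pmin]] :=
  @prime_filter_separation_min _ A^d Y (pf_set V) dY (prime_filter_filtered V).
  by move=> x y Yx Vy yx; apply: (YV x) => //; apply: (pf_up (prime_filterP V) yx).
have [Pt Pup Pm Pb Pj] := prime_filterP P.
have P' : setC (pf_set P) \in @is_prime_filter _ A.
  apply/asboolP; split.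
  - exact: Pb.
  - by move=> a b ab nPa Pb'; apply: nPa; apply: Pup Pb'.
  - by move=> a b nPa nPb /Pj[].
  - by move=> nPt; apply: nPt.
  - move=> a b nPab; apply: contrapT => /not_orP[/contrapT Ja /contrapT Jb].
    by apply: nPab; apply: Pm.
exists (PrimeFilter P'); split => /=.
- by apply/prime_filter_leP => v Vv; apply: VP.
- by move=> y Yy; apply; apply: XP.
- move=> b /contrapT /Pmin[w [z [Pw Xz zw]]]; exists w, z; split => //.
Qed.

(** * Monotonicity of the modal operations, and their preimages of prime filters *)

Section ModalAlgebra.
Context {L : set modality} {A : algebra L} (hA : modal_algebra A).
Implicit Types U V : prime_filter A.

Lemma BoxP_homo (bp : BoxP \in L) : {homo op A bp : x y / x <= y}.
Proof. by move=> x y /meet_idPl xy; rewrite -xy BoxP_meet // leIr. Qed.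

Lemma BoxM_nhomo (bm : BoxM \in L) : {homo op A bm : x y /~ x <= y}.
Proof. by move=> x y /join_idPl <-; rewrite BoxM_join // leIr. Qed.

Lemma DiaP_homo (dp : DiaP \in L) : {homo op A dp : x y / x <= y}.
Proof. by move=> x y /join_idPl <-; rewrite DiaP_join // leUr. Qed.

Lemma DiaM_nhomo (dm : DiaM \in L) : {homo op A dm : x y /~ x <= y}.
Proof. by move=> x y /meet_idPl xy; rewrite -xy DiaM_meet // leUr. Qed.

(** This set and the three below encode the canonical relations: [V] is related to [U] exactly when
    it contains the filtered set (Box+, Diamond-) or avoids the directed one (Box-, Diamond+). *)
Lemma BoxP_filtered (bp : BoxP \in L) U :
  filtered [set x | pf_set U (op A bp x)].
Proof.
have [Ut _ Um _ _] := prime_filterP U.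
split=> [|x y /= Ux Uy]; first by exists \top; rewrite /= BoxP_top.
by exists (x `&` y); [rewrite /= BoxP_meet //; apply: Um|rewrite leIl leIr].
Qed.

Lemma BoxM_directed (bm : BoxM \in L) U :
  directed [set x | pf_set U (op A bm x)].
Proof.
have [Ut _ Um _ _] := prime_filterP U.
split=> [|x y /= Ux Uy]; first by exists \bot; rewrite /= BoxM_bot.
by exists (x `|` y); [rewrite /= BoxM_join //; apply: Um|rewrite leUl leUr].
Qed.

Lemma DiaP_directed (dp : DiaP \in L) U :
  directed [set x | ~ pf_set U (op A dp x)].
Proof.
have [_ _ _ Ub Uj] := prime_filterP U.
split=> [|x y /= Ux Uy]; first by exists \bot; rewrite /= DiaP_bot.
by exists (x `|` y); [rewrite /= DiaP_join // => /Uj[]|rewrite leUl leUr].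
Qed.

Lemma DiaM_filtered (dm : DiaM \in L) U :
  filtered [set x | ~ pf_set U (op A dm x)].
Proof.
have [_ _ _ Ub Uj] := prime_filterP U.
split=> [|x y /= Ux Uy]; first by exists \top; rewrite /= DiaM_top.
by exists (x `&` y); [rewrite /= DiaM_meet // => /Uj[]|rewrite leIl leIr].
Qed.

End ModalAlgebra.

(** * The twelve conditions on the canonical frame *)

Section CanonicalFrame.
Context {L : set modality} {A : algebra L} (hA : unimodal_algebra A).
Implicit Types U V : prime_filter A.

Let mA : modal_algebra A := unimodal_modal hA.

(** An obstruction [x <= v | y] to lowering [V] puts Box+ of the join of [y] and [v] in [U]; the
    axiom then gives Box+ [v] in [U], although [v] is outside [V]. *)
Lemma canonical_BoxP_BoxM (bp : BoxP \in L) (bm : BoxM \in L) U V :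
  canonical_rel bp U V ->
  exists V', [/\ V' <= V, canonical_rel bp U V' & canonical_rel bm U V'].
Proof.
move=> UV; have [Ut Uup Um Ub Uj] := prime_filterP U.
apply: prime_filter_lower; [exact: BoxP_filtered|exact: BoxM_directed|].
move=> v x y nVv /= Ux Uy xvy; apply: nVv; apply: UV.
apply: (Uup _ _ (BoxP_BoxM hA bp bm y v)); apply: Um => //.
by apply: Uup Ux; apply: BoxP_homo; rewrite // joinC.
Qed.

Lemma canonical_BoxM_BoxP (bm : BoxM \in L) (bp : BoxP \in L) U V :
  canonical_rel bm U V ->
  exists V', [/\ V <= V', canonical_rel bp U V' & canonical_rel bm U V'].
Proof.
move=> UV; have [Ut Uup Um Ub Uj] := prime_filterP U.
apply: prime_filter_raise; [exact: BoxP_filtered|exact: BoxM_directed|].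
move=> v x y Vv /= Ux Uy xvy; apply: (UV v) => //.
apply: (Uup _ _ (BoxM_BoxP hA bm bp x v)); apply: Um => //.
by apply: Uup Uy; apply: BoxM_nhomo; rewrite // meetC.
Qed.

(** Given an obstruction, the axiom puts a join in [U]; primality of [U] selects one of its terms,
    and the choice of [x] and [y] excludes both. *)
Lemma canonical_DiaP_DiaM (dp : DiaP \in L) (dm : DiaM \in L) U V :
  canonical_rel dp U V ->
  exists V', [/\ V <= V', canonical_rel dp U V' & canonical_rel dm U V'].
Proof.
move=> UV; have [Ut Uup Um Ub Uj] := prime_filterP U.
have [||v x y Vv /= Ux Uy vxy|V' [VV' xV' yV']] :=
  @prime_filter_raise _ A V [set x | ~ pf_set U (op A dm x)]
    [set x | ~ pf_set U (op A dp x)].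
- exact: DiaM_filtered.
- exact: DiaP_directed.
- have /Uj[] // := Uup _ _ (DiaP_DiaM hA dp dm x v) (UV _ Vv).
  move=> Uxv; apply: Uy; apply: Uup Uxv; apply: DiaP_homo => //.
  by rewrite meetC.
exists V'; split=> // a aV'; apply: contrapT; first by move=> /yV'.
by move=> /xV'.
Qed.

Lemma canonical_DiaM_DiaP (dm : DiaM \in L) (dp : DiaP \in L) U V :
  canonical_rel dm U V ->
  exists V', [/\ V' <= V, canonical_rel dp U V' & canonical_rel dm U V'].
Proof.
move=> UV; have [Ut Uup Um Ub Uj] := prime_filterP U.
have [||v x y Vv /= Ux Uy vxy|V' [VV' xV' yV']] :=
  @prime_filter_lower _ A V [set x | ~ pf_set U (op A dm x)]
    [set x | ~ pf_set U (op A dp x)].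
- exact: DiaM_filtered.
- exact: DiaP_directed.
- have /Uj[] // := Uup _ _ (DiaM_DiaP hA dm dp y v) (UV _ Vv).
  move=> Uxv; apply: Ux; apply: Uup Uxv; apply: DiaM_nhomo => //.
  by rewrite joinC.
exists V'; split=> // a aV'; apply: contrapT; first by move=> /yV'.
by move=> /xV'.
Qed.

(** Now [V] is fixed and [U] moves, so both relations are read as conditions on [U']: contain the
    Diamond- image of the complement of [V], avoid its Box+ image. The axiom has a single [a] under
    both symbols; directedness of the complement supplies a common bound [z] for it. *)
Lemma canonical_BoxP_DiaM (bp : BoxP \in L) (dm : DiaM \in L) U V :
  canonical_rel bp U V ->
  exists U', [/\ U <= U', canonical_rel bp U' V & canonical_rel dm U' V].
Proof.
move=> UV; have [Ut Uup Um Ub Uj] := prime_filterP U.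
have dV := prime_filter_directedC V.
have [||u _ _ Uu [x nVx <-] [y nVy <-] uxy|U' [UU' xU' yU']] :=
  @prime_filter_raise _ A U (op A dm @` setC (pf_set V))
    (op A bp @` setC (pf_set V)).
- by apply: filtered_image_nhomo => //; apply: DiaM_nhomo.
- by apply: directed_image_homo => //; apply: BoxP_homo.
- have [z nVz [xz yz]] := dV.2 _ _ nVx nVy.
  apply: nVz; apply: UV; apply: Uup Uu; apply: (BoxP_DiaM hA (dm := dm)).
  rewrite meetC; apply: le_trans (BoxP_homo mA bp yz); apply: le_trans uxy.
  by rewrite leI2 // DiaM_nhomo.
exists U'; split=> // a; last by move=> nVa; apply: xU'; exists a.
by move=> U'a; apply: contrapT => nVa; apply: (yU' _ _ U'a); exists a.
Qed.

Lemma canonical_BoxM_DiaP (bm : BoxM \in L) (dp : DiaP \in L) U V :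
  canonical_rel bm U V ->
  exists U', [/\ U <= U', canonical_rel bm U' V & canonical_rel dp U' V].
Proof.
move=> UV; have [Ut Uup Um Ub Uj] := prime_filterP U.
have fV := prime_filter_filtered V.
have [||u _ _ Uu [x Vx <-] [y Vy <-] uxy|U' [UU' xU' yU']] :=
  @prime_filter_raise _ A U (op A dp @` pf_set V) (op A bm @` pf_set V).
- by apply: filtered_image_homo => //; apply: DiaP_homo.
- by apply: directed_image_nhomo => //; apply: BoxM_nhomo.
- have [z Vz [zx zy]] := fV.2 _ _ Vx Vy.
  apply: (UV z) => //; apply: Uup Uu; apply: (BoxM_DiaP hA (dp := dp)).
  rewrite meetC; apply: le_trans (BoxM_nhomo mA bm zy); apply: le_trans uxy.
  by rewrite leI2 // DiaP_homo.
exists U'; split=> // a; last by move=> Va; apply: xU'; exists a.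
by move=> U'a Va; apply: (yU' _ _ U'a); exists a.
Qed.

(** As [U] moves down, an obstruction involves some [u] outside [U]. The axiom with [u] for [c]
    bounds Diamond+ [z], which is in [U], by [u]. *)
Lemma canonical_DiaP_BoxM (dp : DiaP \in L) (bm : BoxM \in L) U V :
  canonical_rel dp U V ->
  exists U', [/\ U' <= U, canonical_rel bm U' V & canonical_rel dp U' V].
Proof.
move=> UV; have [Ut Uup Um Ub Uj] := prime_filterP U.
have fV := prime_filter_filtered V.
have [||u _ _ nUu [x Vx <-] [y Vy <-] xuy|U' [UU' xU' yU']] :=
  @prime_filter_lower _ A U (op A dp @` pf_set V) (op A bm @` pf_set V).
- by apply: filtered_image_homo => //; apply: DiaP_homo.
- by apply: directed_image_nhomo => //; apply: BoxM_nhomo.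
- have [z Vz [zx zy]] := fV.2 _ _ Vx Vy.
  apply: nUu; apply: Uup (UV _ Vz); apply: (DiaP_BoxM hA (bm := bm)).
  rewrite joinC; apply: (le_trans (DiaP_homo mA dp zx)).
  by apply: (le_trans xuy); rewrite leU2 // BoxM_nhomo.
exists U'; split=> // a; last by move=> Va; apply: xU'; exists a.
by move=> U'a Va; apply: (yU' _ _ U'a); exists a.
Qed.

Lemma canonical_DiaM_BoxP (dm : DiaM \in L) (bp : BoxP \in L) U V :
  canonical_rel dm U V ->
  exists U', [/\ U' <= U, canonical_rel bp U' V & canonical_rel dm U' V].
Proof.
move=> UV; have [Ut Uup Um Ub Uj] := prime_filterP U.
have dV := prime_filter_directedC V.
have [||u _ _ nUu [x nVx <-] [y nVy <-] xuy|U' [UU' xU' yU']] :=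
  @prime_filter_lower _ A U (op A dm @` setC (pf_set V))
    (op A bp @` setC (pf_set V)).
- by apply: filtered_image_nhomo => //; apply: DiaM_nhomo.
- by apply: directed_image_homo => //; apply: BoxP_homo.
- have [z nVz [xz yz]] := dV.2 _ _ nVx nVy.
  apply: nUu; apply: Uup (UV _ nVz); apply: (DiaM_BoxP hA (bp := bp)).
  rewrite joinC; apply: (le_trans (DiaM_nhomo mA dm xz)).
  by apply: (le_trans xuy); rewrite leU2 // BoxP_homo.
exists U'; split=> // a; last by move=> nVa; apply: xU'; exists a.
by move=> U'a; apply: contrapT => nVa; apply: (yU' _ _ U'a); exists a.
Qed.

Lemma canonical_BoxP_DiaP (bp : BoxP \in L) (dp : DiaP \in L) U V :
  canonical_rel bp U V ->
  exists U' V', [/\ U <= U', V' <= V, canonical_rel bp U' V' &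
    canonical_rel dp U' V'].
Proof.
move=> UV; have [Ut Uup Um Ub Uj] := prime_filterP U.
have [V' [V'V UV' V'min]] := prime_filter_lower_min (BoxP_filtered mA bp U) UV.
have [_ _ _ _ V'j] := prime_filterP V'.
have [||u _ _ Uu [b V'b <-] [x nV'x <-] ubx|U' [UU' xU' yU']] :=
  @prime_filter_raise _ A U (op A dp @` pf_set V') (op A bp @` setC (pf_set V')).
- apply: filtered_image_homo; [exact: DiaP_homo|exact: prime_filter_filtered].
- apply: directed_image_homo; [exact: BoxP_homo|exact: prime_filter_directedC].
- have [w [z [nV'w Uz zwb]]] := V'min _ V'b.
  (* The join of [x] and [w] serves as [a] in the axiom: it stays outside [V'] by primality, and
     joined with [b] it lies above [z]. *)
  have /UV' /V'j[] // : pf_set U (op A bp (x `|` w)).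
  apply: (Uup _ _ (BoxP_DiaP hA (dp := dp) (b := b) (c := u) _)).
    by rewrite meetC (le_trans ubx) // BoxP_homo // leUl.
  apply: Um => //; apply: Uup Uz; apply: BoxP_homo => //.
  by rewrite (le_trans zwb) // leU2 // leUr.
exists U', V'; split=> // a; last by move=> V'a; apply: xU'; exists a.
by move=> U'a; apply: contrapT => nVa; apply: (yU' _ _ U'a); exists a.
Qed.

Lemma canonical_BoxM_DiaM (bm : BoxM \in L) (dm : DiaM \in L) U V :
  canonical_rel bm U V ->
  exists U' V', [/\ U <= U', V <= V', canonical_rel bm U' V' &
    canonical_rel dm U' V'].
Proof.
move=> UV; have [Ut Uup Um Ub Uj] := prime_filterP U.
have [V' [VV' UV' V'max]] := prime_filter_raise_max (BoxM_directed mA bm U) UV.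
have [_ _ V'm _ _] := prime_filterP V'.
have [||u _ _ Uu [b nV'b <-] [x V'x <-] ubx|U' [UU' xU' yU']] :=
  @prime_filter_raise _ A U (op A dm @` setC (pf_set V')) (op A bm @` pf_set V').
- apply: filtered_image_nhomo; first exact: DiaM_nhomo.
  exact: prime_filter_directedC.
- apply: directed_image_nhomo; [exact: BoxM_nhomo|exact: prime_filter_filtered].
- have [w [z [V'w Uz wbz]]] := V'max _ nV'b.
  (* Maximality gives [w] in [V'], so the meet of [x] and [w] stays in [V'], while its meet with [b]
     lies below [z]. *)
  apply: (UV' (x `&` w)); last exact: V'm.
  apply: (Uup _ _ (BoxM_DiaM hA (dm := dm) (b := b) (c := u) _)).
    by rewrite meetC (le_trans ubx) // BoxM_nhomo // leIl.
  apply: Um => //; apply: Uup Uz; apply: BoxM_nhomo => //.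
  by rewrite (le_trans _ wbz) // leI2 // leIr.
exists U', V'; split=> // a; last by move=> V'a; apply: xU'; exists a.
by move=> U'a V'a; apply: (yU' _ _ U'a); exists a.
Qed.

Lemma canonical_DiaP_BoxP (dp : DiaP \in L) (bp : BoxP \in L) U V :
  canonical_rel dp U V ->
  exists U' V', [/\ U' <= U, V <= V', canonical_rel bp U' V' &
    canonical_rel dp U' V'].
Proof.
move=> UV; have [Ut Uup Um Ub Uj] := prime_filterP U.
have [|V' [VV' UV' V'max]] :=
  @prime_filter_raise_max _ A V _ (DiaP_directed mA dp U).
  by move=> x nUx /UV.
have [_ _ V'm _ _] := prime_filterP V'.
have [||u _ _ nUu [x V'x <-] [b nV'b <-] xub|U' [UU' xU' yU']] :=
  @prime_filter_lower _ A U (op A dp @` pf_set V') (op A bp @` setC (pf_set V')).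
- apply: filtered_image_homo; [exact: DiaP_homo|exact: prime_filter_filtered].
- apply: directed_image_homo; [exact: BoxP_homo|exact: prime_filter_directedC].
- have [w [z [V'w nUz wbz]]] := V'max _ nV'b.
  (* The axiom is used at this meet instead of [x], so that the remaining Diamond+ term is bounded
     by Diamond+ [z], which is not in [U]. *)
  have Uxw : pf_set U (op A dp (x `&` w)).
    by apply: contrapT => /UV'; apply; apply: V'm.
  have /Uj[] // : pf_set U (op A dp (x `&` w `&` b) `|` u).
    apply: Uup Uxw; apply: (DiaP_BoxP hA (bp := bp)); rewrite joinC.
    by apply: le_trans xub; rewrite DiaP_homo // leIl.
  move=> Uxwb; apply: nUz; apply: Uup Uxwb; apply: DiaP_homo => //.
  by apply: le_trans wbz; rewrite leI2 // leIr.
exists U', V'; split=> // a; last by move=> V'a; apply: xU'; exists a.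
by move=> U'a; apply: contrapT => nVa; apply: (yU' _ _ U'a); exists a.
Qed.

Lemma canonical_DiaM_BoxM (dm : DiaM \in L) (bm : BoxM \in L) U V :
  canonical_rel dm U V ->
  exists U' V', [/\ U' <= U, V' <= V, canonical_rel bm U' V' &
    canonical_rel dm U' V'].
Proof.
move=> UV; have [Ut Uup Um Ub Uj] := prime_filterP U.
have [|V' [V'V UV' V'min]] :=
  @prime_filter_lower_min _ A V _ (DiaM_filtered mA dm U).
  by move=> x nUx; apply: contrapT => /UV.
have [_ _ _ _ V'j] := prime_filterP V'.
have [||u _ _ nUu [x nV'x <-] [b V'b <-] xub|U' [UU' xU' yU']] :=
  @prime_filter_lower _ A U (op A dm @` setC (pf_set V')) (op A bm @` pf_set V').
- apply: filtered_image_nhomo; first exact: DiaM_nhomo.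
  exact: prime_filter_directedC.
- apply: directed_image_nhomo; [exact: BoxM_nhomo|exact: prime_filter_filtered].
- have [w [z [nV'w nUz zwb]]] := V'min _ V'b.
  (* By primality the join of [x] and [w] is outside [V']; joined with [b] it exceeds [z], and
     Diamond- reverses the order. *)
  have Uxw : pf_set U (op A dm (x `|` w)).
    by apply: contrapT => /UV' /V'j[].
  have /Uj[] // : pf_set U (op A dm (x `|` w `|` b) `|` u).
    apply: Uup Uxw; apply: (DiaM_BoxM hA (bm := bm)); rewrite (joinC _ u).
    by apply: le_trans xub; rewrite DiaM_nhomo // leUl.
  move=> Uxwb; apply: nUz; apply: Uup Uxwb; apply: DiaM_nhomo => //.
  by apply: (le_trans zwb); rewrite leU2 // leUr.
exists U', V'; split=> // a; last by move=> V'a; apply: xU'; exists a.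
by move=> U'a Va; apply: (yU' _ _ U'a); exists a.
Qed.

End CanonicalFrame.

(** * The modal identities in complex algebras *)

Lemma complex_modal (L : set modality) (F : frame L) :
  modal_algebra (complex_algebra F).
Proof.
split.
- move=> bp a b; apply: upset_eqP => u; rewrite !upset_meetE; split.
    by move=> uab; split=> v /uab; rewrite upset_meetE => -[].
  by move=> [ua ub] v uv; rewrite upset_meetE; split; [apply: ua|apply: ub].
- by move=> bp; apply: upset_eqP.
- move=> bm a b; apply: upset_eqP => u; rewrite upset_meetE; split.
    move=> uab; split=> v /uab nab vab; apply: nab; rewrite upset_joinE.
      by left.
    by right.
  by move=> [ua ub] v uv; rewrite upset_joinE => -[]; [apply: ua|apply: ub].
- by move=> bm; apply: upset_eqP => u; split=> // _ v _ [].
- move=> dp a b; apply: upset_eqP => u; rewrite upset_joinE; split.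
    by move=> [v]; rewrite upset_joinE => -[av|bv] uv; [left|right]; exists v.
  move=> [[v av uv]|[v bv uv]]; exists v => //; rewrite upset_joinE.
    by left.
  by right.
- by move=> dp; apply: upset_eqP => u; split=> [[]|].
- move=> dm a b; apply: upset_eqP => u; rewrite upset_joinE; split.
    move=> [v]; rewrite upset_meetE => /not_andP[nav|nbv] uv.
      by left; exists v.
    by right; exists v.
  by move=> [[v nv uv]|[v nv uv]]; exists v => //; rewrite upset_meetE => -[].
- by move=> dm; apply: upset_eqP => u; split=> [[v []]|].
Qed.

(** * Transfer of the axioms to the canonical extension *)

Theorem mainTheorem5 (L : set modality) (A : algebra L) :
  unimodal_algebra A -> unimodal_algebra (canonical_extension A).
Proof.
move=> hA; split; first exact: complex_modal.
- move=> bp bm a b; apply/upset_leP => U; rewrite upset_meetE => -[Ua Uab] V UV.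
  have [V' [V'V bpV' bmV']] := canonical_BoxP_BoxM hA bm UV.
  apply: upset_up V'V _.
  by have := Uab _ bpV'; rewrite upset_joinE => -[/(Ua _ bmV')|].
- move=> bm bp a b; apply/upset_leP => U; rewrite upset_meetE => -[Ua Uab].
  move=> V UV bV.
  have [V' [VV' bpV' bmV']] := canonical_BoxM_BoxP hA bp UV.
  apply: (Uab _ bmV'); rewrite upset_meetE; split; first exact: Ua.
  exact: upset_up VV' bV.
- move=> dp dm a b; apply/upset_leP => U [V bV UV]; rewrite upset_joinE.
  have [V' [VV' pV' mV']] := canonical_DiaP_DiaM hA dm UV.
  (* Membership of [V'] in [a] decides which of the two diamonds it witnesses at [U]. *)
  have [aV'|naV'] := pselect (upset_set a V'); last by right; exists V'.
  left; exists V' => //; rewrite upset_meetE; split=> //.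
  exact: upset_up VV' bV.
- move=> dm dp a b; apply/upset_leP => U [V nbV UV]; rewrite upset_joinE.
  have [V' [V'V pV' mV']] := canonical_DiaM_DiaP hA dp UV.
  have [aV'|naV'] := pselect (upset_set a V'); first by right; exists V'.
  left; exists V' => //; rewrite upset_joinE => -[//|bV'].
  by apply: nbV; apply: upset_up V'V bV'.
- move=> bp dm a c /upset_leP ac; apply/upset_leP => U cU V UV.
  have [U' [UU' bU' dU']] := canonical_BoxP_DiaM hA dm UV.
  (* Assuming [V] outside [a] makes it a Diamond- witness at [U'], so the hypothesis yields Box+ [a]
     there and [V] is in [a] after all. *)
  apply: contrapT => naV; apply: (naV); apply: (ac U' _) bU'.
  rewrite upset_meetE; split; first by exists V.
  exact: upset_up UU' cU.
- move=> bm dp a c /upset_leP ac; apply/upset_leP => U cU V UV aV.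
  have [U' [UU' bU' dU']] := canonical_BoxM_DiaP hA dp UV.
  apply: (ac U' _ V bU' aV).
  rewrite upset_meetE; split; first by exists V.
  exact: upset_up UU' cU.
- move=> dp bm a c /upset_leP ac; apply/upset_leP => U [V aV UV].
  have [U' [U'U bU' dU']] := canonical_DiaP_BoxM hA bm UV.
  apply: upset_up U'U _.
  (* Box- [a] fails at [U'] because of [V], which leaves [c]. *)
  have := ac U'; rewrite upset_joinE => -[|U'a|//]; first by exists V.
  by case: (U'a V).
- move=> dm bp a c /upset_leP ac; apply/upset_leP => U [V naV UV].
  have [U' [U'U bU' dU']] := canonical_DiaM_BoxP hA bp UV.
  apply: upset_up U'U _.
  have := ac U'; rewrite upset_joinE => -[|U'a|//]; first by exists V.
  by case: naV; apply: U'a.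
- move=> bp dp a b c /upset_leP abc; apply/upset_leP => U.
  rewrite upset_meetE => -[Uab cU] V UV.
  have [U' [V' [UU' V'V bU' dU']]] := canonical_BoxP_DiaP hA dp UV.
  apply: upset_up V'V _.
  (* The Box+ relation passes from [U'] down to [U], so the hypothesis at [U] can be evaluated at
     [V']. *)
  have UV' : canonical_rel bp U V'.
    by move=> x Ux; apply: bU'; apply: (prime_filter_leP U U').1 Ux.
  have := Uab _ UV'; rewrite upset_joinE => -[//|bV'].
  apply: (abc U' _) bU'; rewrite upset_meetE; split; first by exists V'.
  exact: upset_up UU' cU.
- move=> bm dm a b c /upset_leP abc; apply/upset_leP => U.
  rewrite upset_meetE => -[Uab cU] V UV aV.
  have [U' [V' [UU' VV' bU' dU']]] := canonical_BoxM_DiaM hA dm UV.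
  have aV' : upset_set a V' by apply: upset_up VV' aV.
  have UV' : canonical_rel bm U V'.
    by move=> x Ux; apply: bU'; apply: (prime_filter_leP U U').1 Ux.
  apply: (abc U' _ V' bU' aV'); rewrite upset_meetE; split.
    by exists V' => // bV'; apply: (Uab _ UV'); rewrite upset_meetE.
  exact: upset_up UU' cU.
- move=> dp bp a b c /upset_leP abc; apply/upset_leP => U [V aV UV].
  have [U' [V' [U'U VV' bU' dU']]] := canonical_DiaP_BoxP hA bp UV.
  have aV' : upset_set a V' by apply: upset_up VV' aV.
  rewrite upset_joinE.
  have := abc U'; rewrite upset_joinE => -[|U'b|cU']; first by exists V'.
    left; exists V'; first by rewrite upset_meetE; split=> //; apply: U'b.
    (* The Diamond+ relation passes from [U'] up to [U]. *)
    by move=> x /dU'; apply: (prime_filter_leP U' U).1.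
  by right; apply: upset_up U'U _.
- move=> dm bm a b c /upset_leP abc; apply/upset_leP => U [V naV UV].
  have [U' [V' [U'U V'V bU' dU']]] := canonical_DiaM_BoxM hA bm UV.
  have naV' : ~ upset_set a V' by move=> aV'; apply: naV; apply: upset_up V'V _.
  rewrite upset_joinE.
  have := abc U'; rewrite upset_joinE => -[|U'b|cU']; first by exists V'.
    left; exists V'; first by rewrite upset_joinE => -[//|]; apply: U'b.
    by move=> x /dU'; apply: (prime_filter_leP U' U).1.
  by right; apply: upset_up U'U _.
Qed.
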